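(* Let $(\Sigma,g)$ be a closed Riemann surface with bundle $\bar K$ of $(0,1)$-forms and let $E\to\Sigma$ be a holomorphic bundle of rank $r$ with a Hermitian metric. Let $\overline{\mu}\in\Gamma(\Sigma,\bar K\otimes_{\mathbb{C}}\mathrm{Sym}^2_{\mathbb{C}}E)$, let $\mu:E\to\bar K E$ be the associated conjugate linear map, and set $$\mathcal{A}=\begin{pmatrix}0&\mu^*\\ \mu&0\end{pmatrix}\in\mathrm{End}_{\mathbb{R}}(E\oplus\bar K E).$$ Let $c$ be the symbol of the Dirac operator $D=\begin{pmatrix}0&\bar\partial^*\\ \bar\partial&0\end{pmatrix}$ on $\Gamma(E\oplus\bar K E)$. Then $(c,\mathcal{A})$ is a concentrating pair.
   Context: $\bar K E$ means $\bar K\otimes_{\mathbb{C}}E$. The Hermitian metric $\langle\cdot,\cdot\rangle$ is conjugate linear in the second argument. The symbol $c$, applied to a $(0,1)$-form $u$ (real covectors being identified with their $(0,1)$ parts), is $c(u)\xi=u\wedge\xi-\iota_u\xi$ for $\xi\in E\oplus\bar K E$, where $\iota_u$ is the adjoint of $u\wedge$. The map $\mu$ is obtained from $\overline\mu$ via the conjugate linear isomorphism $E\cong E^*$ defined by the Hermitian metric: in a unitary basis $\{e_i\}$ of $E_p$ and a unit vector $\bar k\in\bar K_p$, if $\overline\mu=\bar k\,\mu^{ij}e_i\otimes e_j$ then $\mu(\xi)=\bar k\,\langle e_i,\xi\rangle\mu^{ij}e_j$ (summation over repeated indices). Here $\mu^*$ is the adjoint of the real linear map $\mu$ with respect to the real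 inner products $\mathrm{Re}\langle\cdot,\cdot\rangle$. A pair $(\sigma,\mathcal{A})$, with $\sigma:T^*\Sigma\to\mathrm{Hom}(V,W)$ a symbol and $\mathcal{A}:V\to W$ a real bundle map between metric bundles, is a concentrating pair if $\mathcal{A}^*\circ\sigma(u)=\sigma(u)^*\circ\mathcal{A}$ for every $u\in T^*\Sigma$ (real adjoints). *)

(* Defs.v *)
From HB Require Import structures.
From mathcomp Require Import all_boot all_order all_algebra.
From mathcomp Require Import all_classical all_reals all_analysis.
From mathcomp Require Import complex.
From mathcomp Require Import ring.
Set Implicit Arguments.
Unset Strict Implicit.
Unset Printing Implicit Defensive.
Import Order.TTheory GRing.Theory Num.Theory.
Import numFieldNormedType.Exports.
Local Open Scope classical_set_scope.
Local Open Scope ring_scope.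
Local Open Scope complex_scope.

(* R[i] carries its topology and its normed-module structure over itself only
   as R[i]^o; derivability over the complex field is holomorphy. *)
Definition holomorphic_on (R : realType) (O : set R[i]) (f : R[i] -> R[i]) :=
  forall z, O z -> derivable (f : R[i]^o -> R[i]^o) z 1.

Definition cderiv (R : realType) (f : R[i] -> R[i]) (z : R[i]) : R[i] :=
  'D_1 (f : R[i]^o -> R[i]^o) z.

(* Only meant for O open. *)
Fixpoint Ck_on (R : realType) (k : nat) (O : set (R * R)) (f : R * R -> R) :
    Prop :=
  match k with
  | 0 => forall x, O x -> {for x, continuous f}
  | k'.+1 => (forall x, O x -> differentiable f x) /\
             (forall v, Ck_on k' O (fun x => 'D_v f x))
  end.

Definition Cinfty_on (R : realType) (O : set (R * R)) (f : R * R -> R) :=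
  forall k, Ck_on k O f.

(* Hausdorff, compact and locally Euclidean, hence second countable.  Every
   point has a preferred chart [rs_at p]: it identifies the tangent space at p
   with R[i] and thus gives coordinates on the fibers of T* and Kbar. *)
Record closed_riemann_surface (R : realType) := ClosedRiemannSurface {
  rs_space :> topologicalType;
  rs_hausdorff : hausdorff_space rs_space;
  rs_compact : compact [set: rs_space];
  rs_idx : Type;
  rs_dom : rs_idx -> set rs_space;
  rs_dom_open : forall i, open (rs_dom i);
  rs_chart : rs_idx -> rs_space -> R[i];
  rs_inv : rs_idx -> R[i] -> rs_space;
  rs_chartK : forall i p, rs_dom i p -> rs_inv i (rs_chart i p) = p;
  rs_image_open : forall i, open (rs_chart i @` rs_dom i : set R[i]^o);
  rs_chart_continuous : forall i p, rs_dom i p ->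
    {for p, continuous (rs_chart i : rs_space -> R[i]^o)};
  rs_inv_continuous : forall i z, (rs_chart i @` rs_dom i) z ->
    {for z, continuous (rs_inv i : R[i]^o -> rs_space)};
  rs_trans_holomorphic : forall i j,
    holomorphic_on (rs_chart i @` (rs_dom i `&` rs_dom j))
                   (rs_chart j \o rs_inv i);
  rs_at : rs_space -> rs_idx;
  rs_at_dom : forall p, rs_dom (rs_at p) p
}.

Section Surface.
Variables (R : realType) (S : closed_riemann_surface R).
Local Notation C := R[i].

(* dz_j / dz_i at p, where z_i is the coordinate of the chart i *)
Definition dtrans (i j : rs_idx S) (p : S) : C :=
  cderiv (rs_chart j \o rs_inv i) (rs_chart i p).

Definition surf_holomorphic_on (U : set S) (f : S -> C) :=
  forall i : rs_idx S,
    holomorphic_on (rs_chart i @` (rs_dom i `&` U)) (f \o rs_inv i).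

Definition surf_smooth_on (U : set S) (f : S -> C) :=
  forall i : rs_idx S,
    let O := [set x : R * R | (rs_chart i @` (rs_dom i `&` U)) (x.1 +i* x.2)] in
    let g := fun x : R * R => f (rs_inv i (x.1 +i* x.2)) in
    Cinfty_on O (fun x => complex.Re (g x)) /\
    Cinfty_on O (fun x => complex.Im (g x)).

(* Riemannian metric in the conformal class of the complex structure: at p it
   is lam p * |dz|^2, z being the coordinate of the preferred chart at p. *)
Record conformal_metric := ConformalMetric {
  lam :> S -> R;
  lam_gt0 : forall p, 0 < lam p;
  lam_smooth : forall i, surf_smooth_on (rs_dom i) (fun p =>
    (lam p)%:C * (dtrans i (rs_at p) p * (dtrans i (rs_at p) p)^*))
}.

(* Real covector u.1 dx + u.2 dy at p, z = x + iy the preferred coordinate. *)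
Definition cotangent : Type := (R^o * R^o)%type.

(* Coefficient of dzbar in the (0,1) part of u.1 dx + u.2 dy. *)
Definition form01 (u : cotangent) : C := (u.1 +i* u.2) / 2.

End Surface.

(* Bundle given by its transition cocycle over a trivializing cover:
   [hb_trans a b p] sends coordinates in the trivialization a to coordinates
   in the trivialization b.  The fiber over p is 'cV[R[i]]_r by means of the
   preferred trivialization [hb_at p]. *)
Record holomorphic_bundle (R : realType) (S : closed_riemann_surface R)
    (r : nat) := HolomorphicBundle {
  hb_idx : Type;
  hb_dom : hb_idx -> set S;
  hb_dom_open : forall a, open (hb_dom a);
  hb_trans : hb_idx -> hb_idx -> S -> 'M[R[i]]_r;
  hb_trans_id : forall a p, hb_dom a p -> hb_trans a a p = 1%:M;
  hb_trans_comp : forall a b c p, hb_dom a p -> hb_dom b p -> hb_dom c p ->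
    hb_trans b c p *m hb_trans a b p = hb_trans a c p;
  hb_trans_holomorphic : forall a b k l,
    surf_holomorphic_on (hb_dom a `&` hb_dom b)
                        (fun p => hb_trans a b p k l);
  hb_at : S -> hb_idx;
  hb_at_dom : forall p, hb_dom (hb_at p) p
}.

(* Sesquilinear, conjugate linear in the second argument. *)
Definition sesq (R : realType) (r : nat) (H : 'M[R[i]]_r) (x y : 'cV[R[i]]_r) :
    R[i] :=
  \sum_a \sum_b x a 0 * H a b * (y b 0)^*.

(* [hm p] is the Gram matrix in the preferred trivialization at p; smoothness is
   that of the Gram matrices in every trivialization a. *)
Record hermitian_metric (R : realType) (S : closed_riemann_surface R) (r : nat)
    (E : holomorphic_bundle S r) := HermitianMetric {
  hm :> S -> 'M[R[i]]_r;
  hm_herm : forall p x y, sesq (hm p) y x = (sesq (hm p) x y)^*;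
  hm_posdef : forall p x, x != 0 -> 0 < sesq (hm p) x x;
  hm_smooth : forall (a : hb_idx E) k l, surf_smooth_on (hb_dom a) (fun p =>
    sesq (hm p) (col k (hb_trans a (hb_at E p) p))
                (col l (hb_trans a (hb_at E p) p)))
}.

(* The adjoint of f : V -> W for the real inner products gV and gW, evaluated
   at y: the x such that gW (f v) y = gV v x for all v. *)
Definition adjoint (R : realType) (V W : lmodType R[i])
    (gV : V -> V -> R) (gW : W -> W -> R) (f : V -> W) (y : W) : V :=
  xget 0 [set x | forall v, gW (f v) y = gV v x].

Definition real_linear (R : realType) (V W : lmodType R[i]) (f : V -> W) :=
  forall (a : R) x y, f (a%:C *: x + y) = a%:C *: f x + f y.

(* V and W are the typical fibers of two bundles over X, with inner products
   gV p and gW p on the fibers over p. *)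
Definition concentrating_pair (R : realType) (X : Type) (T : lmodType R)
    (V W : lmodType R[i]) (gV : X -> V -> V -> R) (gW : X -> W -> W -> R)
    (sigma : X -> T -> V -> W) (A : X -> V -> W) : Prop :=
  [/\ forall p u, real_linear (sigma p u),
      forall p (a : R) u v x,
        sigma p (a *: u + v) x = a%:C *: sigma p u x + sigma p v x,
      forall p, real_linear (A p) &
      forall p u,
        adjoint (gV p) (gW p) (A p) \o sigma p u =
        adjoint (gV p) (gW p) (sigma p u) \o A p].

Section DiracBundle.
Variables (R : realType) (S : closed_riemann_surface R).
Variables (g : conformal_metric S) (r : nat) (E : holomorphic_bundle S r).
Variable h : hermitian_metric E.
Local Notation C := R[i].
Local Notation Efib := 'cV[C]_r.

(* The fiber of Kbar at p is C (basis dzbar), so that of Kbar E is Efib, the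
   column x standing for dzbar (x) x, and that of Kbar (x) E (x) E is 'M[C]_r,
   the matrix M standing for \sum_(a, b) M a b dzbar (x) e_a (x) e_b. *)

Definition metricE (p : S) (x y : Efib) : C := sesq (h p) x y.

(* Metric on (0,1)-forms induced by g on complex covectors: for
   g = lam |dz|^2 one has |dx|^2 = |dy|^2 = 1 / lam, whence
   |dzbar|^2 = 2 / lam. *)
Definition metricK (p : S) (k l : C) : C := (2 / g p)%:C * (k * l^*).

Definition metricKE (p : S) (x y : Efib) : C :=
  metricK p 1 1 * metricE p x y.

Definition ipE (p : S) (x y : Efib) : R := complex.Re (metricE p x y).
Definition ipKE (p : S) (x y : Efib) : R := complex.Re (metricKE p x y).

Definition Vfib : lmodType C := (Efib * Efib)%type.

Definition ipV (p : S) (x y : Vfib) : R :=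
  complex.Re (metricE p x.1 y.1 + metricKE p x.2 y.2).

(* w /\ _ on E (+) Kbar E, for the (0,1)-form w dzbar; it kills Kbar E as there
   is no (0,2)-form on a surface. *)
Definition wedge (w : C) (x : Vfib) : Vfib := (0, w *: x.1).

Definition wedge_adj (p : S) (w : C) : Vfib -> Vfib :=
  adjoint (ipV p) (ipV p) (wedge w).

(* The symbol of dbar is u |-> (0,1) part of u /\ _, and that of its formal
   adjoint is minus the adjoint; this is D(f s) - f D s for df = u. *)
Definition dirac_symbol (p : S) (u : cotangent R) (x : Vfib) : Vfib :=
  wedge (form01 u) x - wedge_adj p (form01 u) x.

(* Smooth section of Kbar (x) Sym^2 E.  A form k dzbar_(rs_at p) has
   coefficient k * (dz_(rs_at p) / dz_i)^* in the chart i. *)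
Definition section_KSym2 (mubar : S -> 'M[C]_r) : Prop :=
  (forall p, (mubar p)^T = mubar p) /\
  forall (i : rs_idx S) (a : hb_idx E) k l,
    surf_smooth_on (rs_dom i `&` hb_dom a) (fun p =>
      (dtrans i (rs_at p) p)^* *
      (hb_trans (hb_at E p) a p *m mubar p *m (hb_trans (hb_at E p) a p)^T)
        k l).

(* Contraction of the first factor E of Kbar (x) E (x) E with <_, xi> : E^*. *)
Definition mu_of (mubar : S -> 'M[C]_r) (p : S) (xi : Efib) : Efib :=
  \sum_a \sum_b (metricE p (delta_mx a 0) xi * mubar p a b) *: delta_mx b 0.

Lemma metricE_delta p (x xi : Efib) :
  metricE p x xi = \sum_a x a 0 * metricE p (delta_mx a 0) xi.
Proof.
rewrite /metricE /sesq; apply: eq_bigr => a _.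
rewrite [in RHS](bigD1 a) //= [X in _ = _ * (_ + X)]big1 ?addr0.
  by rewrite mulr_sumr; apply: eq_bigr => b _; rewrite mxE !eqxx mul1r mulrA.
by move=> c ca; apply: big1 => b _; rewrite mxE (negbTE ca) /= !mul0r.
Qed.

Lemma mu_of_coord (mubar : S -> 'M[C]_r) p (xi : Efib) c :
  mu_of mubar p xi c 0 = \sum_a metricE p (delta_mx a 0) xi * mubar p a c.
Proof.
rewrite /mu_of summxE; apply: eq_bigr => a _.
rewrite summxE (bigD1 c) //= big1 ?addr0; first by rewrite !mxE !eqxx mulr1.
by move=> b bc; rewrite !mxE eq_sym (negbTE bc) mulr0.
Qed.

(* In a basis e of the fiber and for k in Kbar, both arbitrary and so in
   particular unitary: if mubar = k mu^ij e_i (x) e_j, then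
   mu xi = k <e_i, xi> mu^ij e_j. *)
Lemma mu_of_frame (mubar : S -> 'M[C]_r) p (k : C) (e : 'I_r -> Efib)
    (m : 'I_r -> 'I_r -> C) :
  mubar p = k *: \sum_i \sum_j m i j *: (e i *m (e j)^T) ->
  forall xi, mu_of mubar p xi =
    k *: \sum_i \sum_j (metricE p (e i) xi * m i j) *: e j.
Proof.
move=> Hm xi; apply/colP => c; rewrite mu_of_coord Hm mxE.
under eq_bigr => a _ do rewrite mxE summxE mulrCA mulr_sumr.
rewrite -mulr_sumr summxE exchange_big; congr (_ * _) => /=.
apply: eq_bigr => i _; rewrite summxE.
under eq_bigr => a _ do rewrite summxE mulr_sumr.
rewrite exchange_big; apply: eq_bigr => j _ /=.
rewrite mxE (metricE_delta p (e i)) !mulr_suml; apply: eq_bigr => a _.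
rewrite !mxE big_ord_recl big_ord0 addr0 !mxE.
by rewrite mulrCA mulrA mulrA [in LHS]mulrC !mulrA; ring.
Qed.

Definition perturbation (mubar : S -> 'M[C]_r) (p : S) (x : Vfib) : Vfib :=
  (adjoint (ipE p) (ipKE p) (mu_of mubar p) x.2, mu_of mubar p x.1).

End DiracBundle.

(* Main.v *)
Require Import Defs.
From HB Require Import structures.
From mathcomp Require Import all_boot all_order all_algebra.
From mathcomp Require Import all_classical all_reals all_analysis.
From mathcomp Require Import complex.
Set Implicit Arguments.
Unset Strict Implicit.
Unset Printing Implicit Defensive.

(** Everything happens in one fiber.  Write [k > 0] for the squared norm of
    [dzbar] and [w dzbar] for the (0,1) part of the covector [u].  In the
    coordinates [(x1, x2)] of E (+) Kbar E the adjoint of the wedge product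
    with [w dzbar] is [(x1, x2) |-> (k w^* x2, 0)], so that
      [c(u) (x1, x2) = (- k w^* x2, w x1)],
    which is skew-adjoint ([adjoint_dirac_symbol]).  The symmetry of [mubar]
    says that the complex number [<mu x, y>] is symmetric in x and y
    ([metricE_mu_sym]); hence [mu^* = k mu],
      [A (x1, x2) = (k mu x2, mu x1)],
    and A is self-adjoint ([adjoint_perturbation]).  The claim
    [A^* c(u) = c(u)^* A] thus says that A and c(u) anticommute, and this holds
    because [mu] is conjugate linear: [mu (w x) = w^* mu x]. *)

Import Order.TTheory GRing.Theory Num.Theory.
(* With the ring scope on top, [z^*] is the conjugation of closed fields. *)
Local Open Scope complex_scope.
Local Open Scope ring_scope.

(** The choice made in [adjoint] is forced when the inner product on the source
    is nondegenerate. *)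
Lemma adjoint_eq (R : realType) (V W : lmodType R[i])
    (gV : V -> V -> R) (gW : W -> W -> R) (f : V -> W) (y : W) (x : V) :
  (forall a b, (forall v, gV v a = gV v b) -> a = b) ->
  (forall v, gW (f v) y = gV v x) -> adjoint gV gW f y = x.
Proof.
move=> nondeg fx; rewrite /adjoint; case: xgetP => [z _ /= fz | /(_ x) []//].
by apply: nondeg => v; rewrite -fz fx.
Qed.

Lemma conj_realC (R : realType) (a : R) : (a%:C)^* = a%:C.
Proof. by rewrite /Num.conj /= oppr0. Qed.

Lemma conj_realCM (R : realType) (a : R) (z : R[i]) :
  (a%:C * z)^* = a%:C * z^*.
Proof. by rewrite rmorphM /= conj_realC. Qed.

Lemma Re_realCM (R : realType) (a : R) (z : R[i]) :
  complex.Re (a%:C * z) = a * complex.Re z.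
Proof. by case: z => x y /=; rewrite mul0r subr0. Qed.

Lemma Re_realCMM (R : realType) (a : R) (w z : R[i]) :
  complex.Re (a%:C * w * z) = a * complex.Re (w * z).
Proof. by rewrite -mulrA Re_realCM. Qed.

Lemma Re_conj (R : realType) (z : R[i]) :
  complex.Re z^* = complex.Re z.
Proof. by case: z. Qed.

Section Fiber.
Context (R : realType) (S : closed_riemann_surface R).
Context (g : conformal_metric S) (r : nat) (E : holomorphic_bundle S r).
Context (h : hermitian_metric E) (p : S).
Implicit Types (x y z : 'cV[R[i]]_r) (a w : R[i]).

Lemma metricE_linearl a x y z :
  metricE h p (a *: x + y) z = a * metricE h p x z + metricE h p y z.
Proof.
rewrite /metricE /sesq mulr_sumr -big_split; apply: eq_bigr => i _ /=.
rewrite mulr_sumr -big_split; apply: eq_bigr => j _ /=.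
by rewrite !mxE !mulrDl !mulrA.
Qed.

Lemma metricE_conj x y : metricE h p y x = (metricE h p x y)^*.
Proof. exact: hm_herm. Qed.

Lemma metricE_linearr a x y z :
  metricE h p z (a *: x + y) = a^* * metricE h p z x + metricE h p z y.
Proof.
rewrite metricE_conj metricE_linearl rmorphD rmorphM /=.
by rewrite -!metricE_conj.
Qed.

Lemma metricE0l x : metricE h p 0 x = 0.
Proof.
by have := metricE_linearl (-1) x x x; rewrite scaleN1r addNr mulN1r addNr.
Qed.

Lemma metricE0r x : metricE h p x 0 = 0.
Proof. by rewrite metricE_conj metricE0l rmorph0. Qed.

Lemma metricEZl a x y : metricE h p (a *: x) y = a * metricE h p x y.
Proof. by have := metricE_linearl a x 0 y; rewrite metricE0l !addr0. Qed.

Lemma metricEZr a x y : metricE h p x (a *: y) = a^* * metricE h p x y.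
Proof. by have := metricE_linearr a y 0 x; rewrite metricE0r !addr0. Qed.

Lemma ipE_nondeg x y : (forall z, ipE h p z x = ipE h p z y) -> x = y.
Proof.
move=> xy; apply/eqP; rewrite -subr_eq0; apply/negP => /negP nz.
have := @hm_posdef _ _ _ _ h p _ nz; rewrite ltcE /= => /andP[_].
rewrite -/(metricE h p _ _) -[X in metricE h p _ X]addrC -scaleN1r.
rewrite metricE_linearr rmorphN1 mulN1r raddfD raddfN /=.
by rewrite -!/(ipE h p _ _) xy addNr ltxx.
Qed.

(** Squared norm of [dzbar]. *)
Definition normK : R := 2 / g p.

Lemma normK_gt0 : 0 < normK.
Proof. by rewrite divr_gt0 // lam_gt0. Qed.

Lemma metricKE_normK x y : metricKE g h p x y = normK%:C * metricE h p x y.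
Proof. by rewrite /metricKE /metricK rmorph1 !mulr1. Qed.

Lemma ipKE_normK x y : ipKE g h p x y = normK * ipE h p x y.
Proof. by rewrite /ipKE metricKE_normK Re_realCM. Qed.

Lemma ipV_normK (x y : Vfib R r) :
  ipV g h p x y = ipE h p x.1 y.1 + normK * ipE h p x.2 y.2.
Proof. by rewrite /ipV raddfD /= metricKE_normK Re_realCM. Qed.

Lemma ipV_nondeg (x y : Vfib R r) :
  (forall v, ipV g h p v x = ipV g h p v y) -> x = y.
Proof.
case: x y => [x1 x2] [y1 y2] xy; congr pair; apply: ipE_nondeg => z.
  by have := xy (z, 0); rewrite !ipV_normK /= /ipE !metricE0l mulr0 !addr0.
have := xy (0, z); rewrite !ipV_normK /= /ipE !metricE0l !add0r.
by apply: mulfI; rewrite gt_eqF ?normK_gt0.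
Qed.

Lemma wedge_adjE w (x : Vfib R r) :
  wedge_adj g h p w x = ((normK%:C * w^*) *: x.2, 0).
Proof.
apply: adjoint_eq; first exact: ipV_nondeg.
move=> v; rewrite !ipV_normK /= /ipE metricE0l metricE0r raddf0 mulr0 addr0.
by rewrite add0r metricEZl metricEZr conj_realCM conjCK Re_realCMM.
Qed.

Lemma dirac_symbolE u (x : Vfib R r) :
  dirac_symbol g h p u x =
  (- (normK%:C * (form01 u)^*) *: x.2, form01 u *: x.1).
Proof.
rewrite /dirac_symbol wedge_adjE /wedge; congr pair; rewrite /= ?subr0 //.
by rewrite sub0r scaleNr.
Qed.

Lemma form01_linear (a : R) (u v : cotangent R) :
  form01 (a *: u + v) = a%:C * form01 u + form01 v.
Proof.
rewrite /form01 mulrA -mulrDl; congr (_ / _).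
by apply/eqP; rewrite eq_complex /= !mul0r subr0 addr0 !eqxx.
Qed.

(** The symbol is skew-adjoint. *)
Lemma adjoint_dirac_symbol u (x : Vfib R r) :
  adjoint (ipV g h p) (ipV g h p) (dirac_symbol g h p u) x =
  - dirac_symbol g h p u x.
Proof.
apply: adjoint_eq; first exact: ipV_nondeg.
move=> v; rewrite !dirac_symbolE !ipV_normK /= /ipE -!scaleNr opprK.
rewrite !metricEZl !metricEZr conj_realCM conjCK rmorphN /= !mulNr !raddfN /=.
by rewrite !Re_realCMM mulrN addrC.
Qed.

Context (mubar : S -> 'M[R[i]]_r).
Local Notation mu := (mu_of h mubar p).

Lemma mu_conj_linear a x y : mu (a *: x + y) = a^* *: mu x + mu y.
Proof.
apply/colP => c; rewrite !mxE !mu_of_coord mulr_sumr -big_split.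
by apply: eq_bigr => b _ /=; rewrite metricE_linearr mulrDl mulrA.
Qed.

Lemma muZ a x : mu (a *: x) = a^* *: mu x.
Proof.
apply/colP => c; rewrite !mxE !mu_of_coord mulr_sumr.
by apply: eq_bigr => b _ /=; rewrite metricEZr mulrA.
Qed.

Context (mubar_sym : (mubar p)^T = mubar p).

(** The only use of the symmetry of [mubar]: both sides are
    [sum_(a, b) <e_a, x> mubar_ab <e_b, y>] up to exchanging a and b. *)
Lemma metricE_mu_sym x y : metricE h p (mu x) y = metricE h p (mu y) x.
Proof.
rewrite (metricE_delta h p (mu x)) (metricE_delta h p (mu y)).
under eq_bigr => b _ do rewrite mu_of_coord mulr_suml.
under [RHS]eq_bigr => b _ do rewrite mu_of_coord mulr_suml.
rewrite exchange_big; apply: eq_bigr => b _; apply: eq_bigr => c _ /=.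
by rewrite -[in LHS]mubar_sym mxE mulrAC [in RHS]mulrAC [X in X * _]mulrC.
Qed.

Lemma adjoint_mu x :
  adjoint (ipE h p) (ipKE g h p) mu x = normK%:C *: mu x.
Proof.
apply: adjoint_eq; first exact: ipE_nondeg.
move=> v; rewrite ipKE_normK /ipE metricE_mu_sym metricEZr conj_realC.
by rewrite Re_realCM [in RHS]metricE_conj Re_conj.
Qed.

Lemma perturbationE (x : Vfib R r) :
  perturbation g h mubar p x = (normK%:C *: mu x.2, mu x.1).
Proof. by rewrite /perturbation adjoint_mu. Qed.

(** The perturbation is self-adjoint. *)
Lemma adjoint_perturbation (x : Vfib R r) :
  adjoint (ipV g h p) (ipV g h p) (perturbation g h mubar p) x =
  perturbation g h mubar p x.
Proof.
apply: adjoint_eq; first exact: ipV_nondeg.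
move=> v; rewrite !perturbationE !ipV_normK /= /ipE metricEZl metricEZr.
rewrite conj_realC !Re_realCM addrC; congr (_ * _ + _ * _).
  by rewrite metricE_mu_sym metricE_conj Re_conj.
by rewrite metricE_mu_sym metricE_conj Re_conj.
Qed.

Lemma perturbation_dirac_anticomm u (x : Vfib R r) :
  perturbation g h mubar p (dirac_symbol g h p u x) =
  - dirac_symbol g h p u (perturbation g h mubar p x).
Proof.
rewrite !perturbationE !dirac_symbolE /= !muZ; congr pair.
  by rewrite /= -!scaleNr opprK scalerA.
by rewrite /= -scaleNr scalerA rmorphN /= conj_realCM conjCK mulNr mulrC.
Qed.

End Fiber.

Theorem lemma3p1 (R : realType) (S : closed_riemann_surface R)
    (g : conformal_metric S) (r : nat) (E : holomorphic_bundle S r)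
    (h : hermitian_metric E) (mubar : S -> 'M[R[i]%C]_r)
    (hmubar : section_KSym2 E mubar) :
  concentrating_pair (ipV g h) (ipV g h)
    (dirac_symbol g h) (perturbation g h mubar).
Proof.
case: hmubar => msym _; split.
- move=> p u a x y; rewrite !dirac_symbolE; congr pair => /=.
    by rewrite scalerDr !scalerA [_ * a%:C]mulrC.
  by rewrite scalerDr !scalerA [_ * a%:C]mulrC.
- move=> p a u v x; rewrite !dirac_symbolE form01_linear.
  rewrite rmorphD /= conj_realCM; congr pair => /=.
    by rewrite mulrDr opprD scalerDl scalerA mulrN mulrCA.
  by rewrite scalerDl scalerA.
- move=> p a x y; rewrite !perturbationE //; congr pair => /=.
    by rewrite mu_conj_linear conj_realC scalerDr !scalerA mulrC.
  by rewrite mu_conj_linear conj_realC.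
- move=> p u; apply/funext => x /=.
  rewrite adjoint_perturbation // adjoint_dirac_symbol.
  exact: perturbation_dirac_anticomm.
Qed.
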